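(* Let $d\ge 1$ be an integer, let $(\alpha,A)$ be the parameters of a phase type (PH) distribution with mean $1/\mu$, let $0<\lambda<\mu$, and let $\pi_0\in(0,1]$ be the equilibrium probability that the dispatcher's memory is empty. Let $R$ be the response time for the memory dependent version of the SQ($d$) policy with arrival rate $\lambda$ and PH distributed job sizes with parameters $(\alpha,A)$. Let $\tilde R$ be the response time for the classic SQ($d$) policy (without memory) with the same job size distribution and arrival rate $\lambda\pi_0^{1/d}$. Then $R$ and $\tilde R$ have the same distribution.
   Context: PH distribution: $\alpha=(\alpha_i)_{i=1}^n$ is a stochastic vector and $A=(a_{i,j})_{i,j=1}^n$ a subgenerator matrix such that the job size has complementary cdf $\bar G(w)=\alpha e^{Aw}\mathbf 1$ (so $\bar G(0)=1$), with $\mathbf 1$ the column vector of ones. A job starts service in phase $i$ with probability $\alpha_i$, its phase evolves according to $A$ while it is in service, and it completes from phase $j$ at rate $\nu_j$, where $\nu=-A\mathbf 1$. Queue at the cavity for SQ($d$) with memory, arrival rate $\lambda$, empty-memory probability $\pi_0$, in equilibrium: a single first-come-first-served queue whose state is (number of jobs, phase of the job at the head of the queue), or empty. Let $u_k$ be the equilibrium probability of having at least $k$ jobs. - Potential arrivals occur at rate $\lambda d\pi_0$. At a potential arrival, $d-1$ i.i.d. queue lengths with the equilibrium queue length law of the queue at the cavity are drawn, independent of its state; the job joins the queue at the cavity iff its queue length is the smallest of the $d$ values, ties being broken uniformly at random. - When the queue is empty there is an additional arrival rate $\lambda(1-\pi_0)/(1-u_1)$ (jobs routed to an idle server whose id is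 in memory). - Service of the head job follows the PH dynamics above. The equilibrium is a probability law on the state space that is stationary for this process with rates computed from that same law; ''the'' equilibrium is taken to exist and be unique, for the system with memory and for the system without memory. Response time $R$ (time from arrival until service completion) of an arriving job: with probability $1-\pi_0$ the job is sent to an idle server; with probability $\pi_0$ the job joins a queue of shortest length (ties broken uniformly at random) among $d$ independent queues, each in the equilibrium law of (queue length, phase of the head job). The response time in a first-come-first-served queue is the remaining service time of the head job (if any), plus the sizes of the other waiting jobs, plus the job's own size, where the latter sizes are i.i.d. PH$(\alpha,A)$. The classic SQ($d$) policy with arrival rate $\lambda'$ is the same model with $\lambda$ replaced by $\lambda'$ and $\pi_0$ replaced by $1$. *)

(* Defs.v *)
From HB Require Import structures.
From mathcomp Require Import all_boot all_order all_algebra.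
From mathcomp Require Import all_classical all_reals all_analysis.

Set Implicit Arguments.
Unset Strict Implicit.
Unset Printing Implicit Defensive.

Import Order.TTheory GRing.Theory Num.Theory.
Import numFieldNormedType.Exports.

Local Open Scope classical_set_scope.
Local Open Scope ring_scope.

Section PhaseType.
Variables (R : realType) (n : nat).
Implicit Types (alpha : 'rV[R]_n) (A : 'M[R]_n).

Definition stochastic_vector alpha :=
  (forall i, 0 <= alpha 0 i) /\ \sum_i alpha 0 i = 1.

Definition subgenerator A :=
  (forall i j, i != j -> 0 <= A i j) /\ (forall i, \sum_j A i j <= 0).

Definition expmx A : 'M[R]_n :=
  limn (series (fun k => (k`!%:R)^-1 *: A ^+ k : 'M[R]_n)).

Definition PH_ccdf alpha A (w : R) : R :=
  (alpha *m expmx (w *: A) *m (const_mx 1 : 'cV[R]_n)) 0 0.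

Definition PH_law alpha A (G : set R -> \bar R) :=
  forall w : R, 0 <= w -> G [set x | w < x] = (PH_ccdf alpha A w)%:E.

Definition completion_rate A (j : 'I_n) : R :=
  - (A *m (const_mx 1 : 'cV[R]_n)) j 0.

End PhaseType.

(* None is the empty queue; Some (k, j) is the queue with k.+1 jobs (so k
   waiting ones) whose head job is in phase j. *)
Definition state (n : nat) : Type := option (nat * 'I_n).

Definition queue_length n (s : state n) : nat :=
  if s is Some (k, _) then k.+1 else 0%N.

Section Cavity.
Variables (R : realType) (d n : nat).
Variables (alpha : 'rV[R]_n) (A : 'M[R]_n) (lam pi0 : R).
Implicit Types (p : state n -> R) (s t : state n).

Definition is_law p :=
  (forall s, 0 <= p s) /\ (\esum_(s in [set: state n]) (p s)%:E = 1)%E.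

Definition pr p (B : set (state n)) : R := fine (\esum_(s in B) (p s)%:E)%E.

Definition tail p (k : nat) : R := pr p [set s | (k <= queue_length s)%N].

Definition length_law p (k : nat) : R := pr p [set s | queue_length s = k].

(* Probability that a potential arrival joins a queue of length k: l ranges
   over the values of the d - 1 other queue lengths, and k is selected with
   probability 1 / (1 + number of ties) if no other value is smaller. *)
Definition join_prob p (k : nat) : R :=
  fine (\esum_(l in [set: {ffun 'I_d.-1 -> nat}])
    ((\prod_m length_law p (l m)) *
     (if [forall m, (k <= l m)%N] then (#|[set m | l m == k]%SET|.+1%:R)^-1
      else 0))%:E)%E.

Definition arrival_rate p (k : nat) : R :=
  lam * d%:R * pi0 * join_prob p k +
  (if k == 0%N then lam * (1 - pi0) / (1 - tail p 1) else 0).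

(* Transition rate from s to t, meaningful for s <> t only. *)
Definition rate p s t : R :=
  match s, t with
  | None, None => 0
  | None, Some (l, j) =>
      if l == 0%N then arrival_rate p 0 * alpha 0 j else 0
  | Some (k, i), None =>
      if k == 0%N then completion_rate A i else 0
  | Some (k, i), Some (l, j) =>
      if l == k.+1 then (if i == j then arrival_rate p k.+1 else 0)
      else if l == k then A i j
      else if k == l.+1 then completion_rate A i * alpha 0 j
      else 0
  end.

(* The global balance equations: at every state the outgoing flow equals the
   incoming flow (the rates are bounded, so that these equations characterize
   the stationary laws). *)
Definition stationary (q : state n -> state n -> R) p :=
  forall s, (\esum_(t in [set t | t <> s]) (p s * q s t)%:E =
             \esum_(t in [set t | t <> s]) (p t * q t s)%:E)%E.

(* The second condition says that the rate lam (1 - pi0) / (1 - u_1) of the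
   arrivals through the memory is well defined; there are none if pi0 = 1. *)
Definition equilibrium p :=
  [/\ is_law p, pi0 < 1 -> tail p 1 < 1 & stationary (rate p) p].

End Cavity.

Section ResponseTime.
Variables (R : realType) (d n : nat).

(* Probability of choosing queue i when the d queue lengths are given by l. *)
Definition select (l : 'I_d -> nat) (i : 'I_d) : R :=
  if [forall m, (l i <= l m)%N]
  then (#|[set m | [forall m', (l m <= l m')%N]]%SET|%:R)^-1 else 0.

Variables (alpha : 'rV[R]_n) (A : 'M[R]_n) (pi0 : R) (p : state n -> R).
Variables (dT : measure_display) (T : measurableType dT) (P : probability T R).

(* X is the response time of an arriving job, where
   - E is the event that the memory is empty,
   - Q m is the state of the m-th sampled queue and J the index of the chosen
     one (these matter on E only),
   - Y j is the remaining service time of a head job found in phase j,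
   - S 0 is the size of the arriving job, S 1, S 2, ... are those of the
     waiting jobs. *)
Definition response_time (X : {RV P >-> R}) :=
  exists (E : T -> bool) (Q : 'I_d -> T -> state n) (J : T -> 'I_d)
         (Y : 'I_n -> {RV P >-> R}) (S : nat -> {RV P >-> R}),
  let choice b q i := [set t | [/\ E t = b, forall m, Q m t = q m & J t = i]] in
  [/\ (forall b q i, measurable (choice b q i) /\
        P (choice b q i) =
          ((if b then pi0 else 1 - pi0) * (\prod_m p (q m)) *
           select (fun m => queue_length (q m)) i)%:E),
      (forall j, PH_law (delta_mx 0 j) A (distribution P (Y j))),
      (forall k, PH_law alpha A (distribution P (S k))),
      (* mutual independence of (E, Q, J), the Y j and the S k *)
      (forall b q i N (U : 'I_n -> set R) (V : nat -> set R),
        (forall j, measurable (U j)) -> (forall k, measurable (V k)) ->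
        P (choice b q i `&`
           [set t | (forall j, U j (Y j t)) /\
                    (forall k, (k < N)%N -> V k (S k t))]) =
        (P (choice b q i) * (\prod_j P (Y j @^-1` U j)) *
         (\prod_(k < N) P (S k @^-1` V k)))%E) &
      (forall t, X t =
        S 0%N t +
        (if E t then
           if Q (J t) t is Some (k, j) then Y j t + \sum_(m < k) S m.+1 t else 0
         else 0))].

End ResponseTime.

(* Main.v *)
Require Import Defs.
From HB Require Import structures.
From mathcomp Require Import all_boot all_order all_algebra.
From mathcomp Require Import all_classical all_reals all_analysis.
From mathcomp Require Import measurable_realfun ring.

Set Implicit Arguments.
Unset Strict Implicit.
Unset Printing Implicit Defensive.

Import Order.TTheory GRing.Theory Num.Theory.
Import numFieldNormedType.Exports.

Local Open Scope classical_set_scope.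
Local Open Scope ring_scope.

(* Put c = pi0^(1/d).  Multiplying by c the equilibrium probability of every
   nonempty state (and giving the rest of the mass to the empty one) turns the
   equilibrium with memory into an equilibrium of the classic policy with rate
   c * lam: the probability of joining a queue of length k >= 1 is homogeneous of
   degree d - 1 in the tail of the queue length law, so these rates agree, while
   u_0^d - u_1^d = 1 - u_1^d gives the agreement of the flows out of the empty
   state.  By uniqueness it is the classic equilibrium.  An arriving job can join
   a nonempty queue only if all d sampled queues are nonempty, so the probability
   of joining a queue in a given nonempty state is multiplied by c^d / pi0 = 1;
   hence the state found by the job (empty if an idle server is used) has the
   same law in both systems, and given that state the response time is the same
   sum of independent PH variables. *)

(** * Sums over countable families *)

Section esum_facts.
Context {R : realType}.
Local Open Scope ereal_scope.

Lemma ge0_esumZl (T : choiceType) (S : set T) (a : T -> \bar R) (c : R) :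
  (0 <= c)%R -> (forall x, S x -> 0 <= a x) ->
  \esum_(x in S) (c%:E * a x) = c%:E * \esum_(x in S) a x.
Proof.
move=> c0 a0; rewrite esum_mkcond [in RHS]esum_mkcond.
have {}a0 x : 0 <= if x \in S then a x else 0.
  by case: ifPn => //; rewrite inE => /a0.
rewrite (eq_esum (b := fun x => c%:E * if x \in S then a x else 0)); last first.
  by move=> x _; case: ifP => //; rewrite mule0.
rewrite /esum -ereal_supZl//; last first.
  apply/set0P; exists 0, set0; first exact: fsets_set0.
  by rewrite fsbig_set0.
congr ereal_sup; rewrite image_comp.
apply: eq_imagel => F [finF FS]; rewrite /comp.
by rewrite ge0_mule_fsumr.
Qed.

Lemma ge0_esumZr (T : choiceType) (S : set T) (a : T -> \bar R) (c : R) :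
  (0 <= c)%R -> (forall x, S x -> 0 <= a x) ->
  \esum_(x in S) (a x * c%:E) = (\esum_(x in S) a x) * c%:E.
Proof.
move=> c0 a0; rewrite muleC -ge0_esumZl//.
by apply: eq_esum => x _; rewrite muleC.
Qed.

(** The pairs [(i, x)] with [f x = i] are reindexed by [x], which determines [i]. *)
Lemma esum_fiber (T I : choiceType) (D : set I) (f : T -> I) (a : T -> \bar R) :
  (forall x, 0 <= a x) ->
  \esum_(i in D) \esum_(x in [set x | f x = i]) a x =
  \esum_(x in f @^-1` D) a x.
Proof.
move=> a0; rewrite esum_esum//.
rewrite [RHS](reindex_esum (D `*`` (fun i => [set x | f x = i])) _ snd)//.
split => [[i x] /= [Di fx]|[i x] [j y]|x Dx].
- by rewrite fx.
- by rewrite !inE/= => -[_ <-] [_ <-] /= ->.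
- by exists (f x, x).
Qed.

Lemma esum_setT_pair (T U : choiceType) (a : T -> U -> \bar R) :
  (forall x y, 0 <= a x y) ->
  \esum_(z in [set: T * U]) a z.1 z.2 =
  \esum_(x in [set: T]) \esum_(y in [set: U]) a x y.
Proof.
move=> a0; rewrite esum_esum//; congr (\esum_(z in _) _)%E.
by apply/seteqP; split => z.
Qed.

End esum_facts.

(** At an infinite [x] both sides are 0, since [c%:E * x] is then infinite or 0. This lets
    [join_prob] be scaled without a proof of convergence. *)
Lemma fine_mulZl (R : realType) (c : R) (x : \bar R) :
  fine (c%:E * x) = c * fine x.
Proof.
case: x => [r| |]//=; rewrite /= ?mulr0.
- rewrite mulry; case: (sgrP c) => _; rewrite ?mul0e ?mul1e ?mulN1e//.
- rewrite mulrNy; case: (sgrP c) => _; rewrite ?mul0e ?mul1e ?mulN1e//.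
Qed.

(** * Uniqueness of finite measures *)

Section measure_facts.
Context {R : realType}.

(** Countable additivity along [nat] is carried to a countable index type by the injection [pickle];
    naturals off its range receive the empty set. *)
Lemma measure_bigcup_esum (d : measure_display) (T : measurableType d)
    (mu : {measure set T -> \bar R}) (I : countType) (D : set I)
    (F : I -> set T) :
  (forall i, D i -> measurable (F i)) -> trivIset D F ->
  mu (\bigcup_(i in D) F i) = (\esum_(i in D) mu (F i))%E.
Proof.
move=> mF tF; pose G k := if pickle_inv k is Some i then F i else set0.
have GE i : G (pickle i) = F i by rewrite /G pickleK_inv.
have -> : \bigcup_(i in D) F i = \bigcup_(k in pickle @` D) G k.
  by rewrite bigcup_image; apply: eq_bigcupr => i _; rewrite GE.
have pI : set_inj D (pickle : I -> nat) by move=> i j _ _; exact: (pcan_inj pickleK).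
rewrite measure_bigcup.
- rewrite nneseries_esum// set_mem_set esum_image//.
  by apply: eq_esum => i _; rewrite GE.
- by move=> _ [i Di <-]; rewrite GE; exact: mF.
- move=> _ _ [i Di <-] [j Dj <-]; rewrite !GE => ij.
  by rewrite (tF i j).
Qed.

Lemma countType_bigcup_measurable (d : measure_display) (T : measurableType d)
    (I : countType) (D : set I) (F : I -> set T) :
  (forall i, D i -> measurable (F i)) -> measurable (\bigcup_(i in D) F i).
Proof.
move=> mF; rewrite bigcup_mkcond; apply: countable_bigcupT_measurable.
  exact: countableP.
by move=> i; case: ifPn => //; rewrite inE => /mF.
Qed.

Lemma finite_measure_unique (d : measure_display) (T : measurableType d)
    (G : set (set T)) (m1 m2 : {measure set T -> \bar R}) :
  measurable = <<s G >> -> setI_closed G -> G setT ->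
  (forall A, G A -> m1 A = m2 A) -> (m1 setT < +oo)%E ->
  forall A, measurable A -> m1 A = m2 A.
Proof.
move=> GE GI GT m12 m1oo.
apply: (measure_unique G (fun=> setT)) => //.
by apply/seteqP; split => // x _; exists 0%N.
Qed.

Lemma measure_setX_unique (d1 d2 : measure_display)
    (T1 : measurableType d1) (T2 : measurableType d2)
    (m1 m2 : {measure set (T1 * T2) -> \bar R}) :
  (m1 setT < +oo)%E ->
  (forall A B, measurable A -> measurable B ->
     m1 (A `*` B) = m2 (A `*` B)) ->
  forall D, measurable D -> m1 D = m2 D.
Proof.
move=> m1oo m12; apply: finite_measure_unique m1oo.
- exact: measurable_prod_measurableType.
- move=> _ _ [A mA [B mB <-]] [A' mA' [B' mB' <-]].
  exists (A `&` A'); first exact: measurableI.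
  exists (B `&` B'); first exact: measurableI.
  by rewrite setXI.
- exists setT => //; exists setT => //; exact: setXTT.
- by move=> _ [A mA [B mB <-]]; exact: m12.
Qed.

(** The rays unbounded to the right are stable under intersection, generate the Borel sets and
    exhaust the line. *)
Lemma eq_tail_probability (P Q : probability R R) :
  (forall w : R, P [set x | w < x] = Q [set x | w < x]) ->
  forall B, measurable B -> P B = Q B.
Proof.
move=> PQ; move=> B; apply: (@measure_unique _ R R (@RGenOInfty.G R)
  (fun k => `](- (k%:R)), +oo[%classic)).
- exact: RGenOInfty.measurableE.
- move=> _ _ [x ->] [y ->]; exists (Num.max x y).
  by apply/seteqP; split=> z /=; rewrite !in_itv/= !andbT gt_max; move/andP.
- by move=> k; exists (- k%:R).
- apply/seteqP; split => // x _; exists (Num.bound `|x|) => //=.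
  rewrite in_itv/= andbT ltrNl; apply: le_lt_trans (archi_boundP (normr_ge0 x)).
  by rewrite -normrN ler_norm.
- move=> _ [x ->]; suff -> : `]x, +oo[%classic = [set z | x < z] by exact: PQ.
  by apply/seteqP; split=> z /=; rewrite in_itv/= andbT.
- by move=> k; rewrite (le_lt_trans (probability_le1 _ _))// ltry.
Qed.

End measure_facts.

(** * Laws of partial sums restricted to an event *)

Section restricted_sum.
Context {R : realType}.

Lemma pushforward_setX_unique (d1 d2 e1 e2 : measure_display)
    (T1 : measurableType d1) (T2 : measurableType d2)
    (U1 : measurableType e1) (U2 : measurableType e2)
    (m1 : {measure set T1 -> \bar R}) (m2 : {measure set T2 -> \bar R})
    (f1 : T1 -> U1 * U2) (f2 : T2 -> U1 * U2) :
  measurable_fun setT f1 -> measurable_fun setT f2 ->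
  (m1 setT < +oo)%E ->
  (forall A B, measurable A -> measurable B ->
     m1 (f1 @^-1` (A `*` B)) = m2 (f2 @^-1` (A `*` B))) ->
  forall D, measurable D -> m1 (f1 @^-1` D) = m2 (f2 @^-1` D).
Proof.
move=> mf1 mf2 m1oo m12 D mD.
pose n1 := measure_function_pushforward__canonical__measure_function_Measure m1 mf1.
pose n2 := measure_function_pushforward__canonical__measure_function_Measure m2 mf2.
exact: (@measure_setX_unique _ _ _ _ _ n1 n2).
Qed.

Lemma measurable_partial_sum (d : measure_display) (T : measurableType d)
    (W : nat -> T -> R) n :
  (forall k, measurable_fun setT (W k)) ->
  measurable_fun setT (fun t => \sum_(k < n) W k t).
Proof. by move=> mW; exact: measurable_sum. Qed.

Lemma measurable_cylinder (d : measure_display) (T : measurableType d)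
    (W : nat -> T -> R) (V : nat -> set R) N :
  (forall k, measurable_fun setT (W k)) -> (forall k, measurable (V k)) ->
  measurable [set t | forall k, (k < N)%N -> V k (W k t)].
Proof.
move=> mW mV.
have -> : [set t | forall k, (k < N)%N -> V k (W k t)] =
    \bigcap_(k in [set k | (k < N)%N]) (W k @^-1` V k) by [].
apply: bigcap_measurableType => k _.
by rewrite -[X in measurable X]setTI; exact: mW.
Qed.

(* Only the restrictions to C and C' are compared, so neither product measures
   nor convolutions are needed: the induction replaces two coordinates by their
   sum, the joint law of the two being determined by its values on rectangles. *)
Lemma partial_sum_preimage_eq (d d' : measure_display)
    (T : measurableType d) (T' : measurableType d')
    (P : probability T R) (P' : probability T' R)
    (C : set T) (C' : set T') (W : nat -> T -> R) (W' : nat -> T' -> R) :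
  measurable C -> measurable C' ->
  (forall k, measurable_fun setT (W k)) ->
  (forall k, measurable_fun setT (W' k)) ->
  (forall N V, (forall k, measurable (V k)) ->
     P (C `&` [set t | forall k, (k < N)%N -> V k (W k t)]) =
     P' (C' `&` [set t | forall k, (k < N)%N -> V k (W' k t)])) ->
  forall n B, measurable B ->
    P (C `&` [set t | B (\sum_(k < n) W k t)]) =
    P' (C' `&` [set t | B (\sum_(k < n) W' k t)]).
Proof.
move=> mC mC' mW mW' WW' n B mB.
(* The induction must carry a cylinder condition on the coordinates from [n] on, because each step
   turns the last summand into such a condition. *)
suff H : forall N (V : nat -> set R), (forall k, measurable (V k)) ->
    P ([set t | B (\sum_(k < n) W k t)] `&`
       (C `&` [set t | forall k, (k < N)%N -> V k (W (n + k)%N t)])) =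
    P' ([set t | B (\sum_(k < n) W' k t)] `&`
       (C' `&` [set t | forall k, (k < N)%N -> V k (W' (n + k)%N t)])).
  have := H 0%N (fun=> setT) (fun=> measurableT).
  have E (S : Type) (X : nat -> S -> R) :
    [set t | forall k, (k < 0)%N -> setT (X (n + k)%N t)] = setT.
    by apply/seteqP; split.
  by rewrite !E !setIT (setIC C) (setIC C').
elim: n B mB => [|n IHn] B mB N V mV.
  have E (S : Type) (X : nat -> S -> R) :
      [set t | B (\sum_(k < 0) X k t)] = if 0 \in B then setT else set0.
    apply/seteqP; split => t /=; rewrite big_ord0.
    + by move=> B0; rewrite mem_set.
    + by case: ifP => //; rewrite inE.
  rewrite !E; case: ifP => _; last by rewrite !set0I !measure0.
  by rewrite !setTI; exact: WW'.
pose D := C `&` [set t | forall k, (k < N)%N -> V k (W (n.+1 + k)%N t)].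
pose D' := C' `&` [set t | forall k, (k < N)%N -> V k (W' (n.+1 + k)%N t)].
have mD : measurable D by apply: measurableI => //; exact: measurable_cylinder.
have mD' : measurable D' by apply: measurableI => //; exact: measurable_cylinder.
pose f t := (\sum_(k < n) W k t, W n t).
pose f' t := (\sum_(k < n) W' k t, W' n t).
have mf : measurable_fun setT f.
  by apply: measurable_fun_pair => //; exact: measurable_partial_sum.
have mf' : measurable_fun setT f'.
  by apply: measurable_fun_pair => //; exact: measurable_partial_sum.
have mS : measurable_fun setT (fun z : R * R => z.1 + z.2).
  by apply: measurable_funD; [exact: measurable_fst|exact: measurable_snd].
pose S := [set z : R * R | B (z.1 + z.2)].
have mSB : measurable S by rewrite -[X in measurable X]setTI; exact: mS.
have E (U : Type) (X : nat -> U -> R) :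
    [set t | B (\sum_(k < n.+1) X k t)] =
    (fun t => (\sum_(k < n) X k t, X n t)) @^-1` S.
  by apply/seteqP; split => t /=; rewrite big_ord_recr.
rewrite !E.
apply: (@pushforward_setX_unique _ _ _ _ _ _ _ _ (mrestr P mD) (mrestr P' mD')
  f f' mf mf') => //.
  by rewrite /mrestr (le_lt_trans (probability_le1 _ _))// ?ltry// setTI.
move=> A U mA mU.
(* On a rectangle the condition [U] on coordinate [n] becomes the first entry of a cylinder longer
   by one, the case covered by [IHn]. *)
pose V1 k := if k is k'.+1 then V k' else U.
have mV1 k : measurable (V1 k) by case: k => [|k] //=; exact: mV.
have F (Q : Type) (X : nat -> Q -> R) (G : set Q) :
    (fun t => (\sum_(k < n) X k t, X n t)) @^-1` (A `*` U) `&`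
    (G `&` [set t | forall k, (k < N)%N -> V k (X (n.+1 + k)%N t)]) =
    [set t | A (\sum_(k < n) X k t)] `&`
    (G `&` [set t | forall k, (k < N.+1)%N -> V1 k (X (n + k)%N t)]).
  apply/seteqP; split => t /= [].
    move=> [At Ut] [Gt Vt]; split => //; split => // -[|k] kN /=.
      by rewrite addn0.
    by rewrite addnS -addSn; exact: Vt.
  move=> At [Gt Vt]; split; first split => //.
    by have := Vt 0%N isT; rewrite addn0.
  by split => // k kN; have := Vt k.+1 kN; rewrite addnS -addSn.
by rewrite /mrestr [LHS](congr1 P (F _ _ _)) [RHS](congr1 P' (F _ _ _)); exact: IHn.
Qed.

End restricted_sum.

(** * Phase type laws are determined by their parameters *)

Section phase_type_law.
Context {R : realType} {n : nat}.

Lemma expmx0 : expmx (0 : 'M[R]_n) = 1%:M.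
Proof.
apply: cvg_lim; first exact: norm_hausdorff.
(* The partial sums are constant from index 1 on; the one of index 0 is empty, hence the shift. *)
rewrite -(cvg_shiftn 1)/=.
apply: cvg_near_cst; near=> k.
rewrite /series/= addn1 big_nat_recl// big1 ?addr0.
  by rewrite fact0 invr1 scale1r expr0.
by move=> i _; rewrite expr0n/= scaler0.
Unshelve. all: by end_near.
Qed.

(* A PH law is prescribed on [0, +oo[ only; expmx 0 = 1 yields total mass 1
   above 0, which settles the negative half-line. *)
Lemma PH_law_unique (alpha : 'rV[R]_n) (A : 'M[R]_n)
    (P Q : probability R R) :
  \sum_i alpha 0 i = 1 -> PH_law alpha A P -> PH_law alpha A Q ->
  forall B, measurable B -> P B = Q B.
Proof.
move=> alpha1 lawP lawQ; apply: eq_tail_probability => w.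
have [w0|w0] := leP 0 w; first by rewrite lawP// lawQ.
have tail1 (G : probability R R) :
    PH_law alpha A G -> G [set x | w < x] = 1%E.
  move=> lawG; apply/eqP; rewrite eq_le probability_le1 ?andTb; last first.
    by rewrite -set_itvoy; exact: measurable_itv.
  have <- : G [set x | 0 < x] = 1%E.
    rewrite lawG// /PH_ccdf scale0r expmx0 mulmx1 mxE.
    by congr (_%:E); rewrite -[RHS]alpha1; apply: eq_bigr => i _; rewrite mxE mulr1.
  apply: le_measure => /=; rewrite ?inE -?set_itvoy; try exact: measurable_itv.
  by move=> x /=; rewrite !in_itv/= !andbT; exact: lt_trans.
by rewrite !tail1.
Qed.

End phase_type_law.

(** * The queue at the cavity *)

Section binomial_mean.
Context {R : realType}.
Variable a : R.

Let x := 1 - a.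

(** In the application [a] is the probability that a queue is empty and [z] counts the empty ones
    among [e] sampled queues. *)
Definition binomial_mean e (phi : nat -> R) :=
  \sum_(z < e.+1) 'C(e, z)%:R * a ^+ z * (1 - a) ^+ (e - z) * phi z.

(** Conditioning on the first trial; algebraically this is Pascal's rule. *)
Lemma binomial_meanS e phi :
  binomial_mean e.+1 phi =
  a * binomial_mean e (phi \o S) + (1 - a) * binomial_mean e phi.
Proof.
rewrite /binomial_mean -/x big_ord_recl/= bin0 expr0 subn0 !mul1r.
under eq_bigr => z _.
  rewrite /bump/= add1n binS natrD subSS !mulrDl.
  over.
rewrite big_split/= addrA addrC; congr (_ + _).
  rewrite mulr_sumr; apply: eq_bigr => z _; rewrite exprS /=; ring.
rewrite big_ord_recr/= bin_small// !mul0r addr0.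
rewrite [in RHS]big_ord_recl/= bin0 expr0 subn0 !mul1r mulrDr mulrA -exprS.
congr (_ + _); rewrite mulr_sumr; apply: eq_bigr => z _.
rewrite /bump/= add1n.
have -> : (e - z = (e - z.+1).+1)%N by rewrite -subSn// subSS.
rewrite (exprS x); ring.
Qed.

(* The binomial average of 1/(z+1) is what a uniform tie-break among the empty
   queues contributes. *)
Lemma binomial_mean_inv e :
  e.+1%:R * a * binomial_mean e (fun z => z.+1%:R^-1) = 1 - (1 - a) ^+ e.+1.
Proof.
(* In the binomial expansion of this power of 1, the term of index 0 is the one subtracted on the
   right. *)
have E : 1 = (x + a) ^+ e.+1 by rewrite /x subrK expr1n.
rewrite [X in X - _]E exprDn big_ord_recl/= bin0 subn0 expr0 mulr1 mulr1n.
rewrite [x ^+ _ + _]addrC addrK.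
rewrite mulr_sumr; apply: eq_bigr => z _.
rewrite /bump/= add1n subSS -[in RHS]mulr_natr.
have z0 : z.+1%:R != 0 :> R by rewrite pnatr_eq0.
(* Absorption identity: [e.+1 * 'C(e, z) = z.+1 * 'C(e.+1, z.+1)]. *)
have := congr1 (fun k : nat => k%:R : R) (mul_bin_diag e.+1 z).
rewrite /= !natrM => H.
apply: (mulfI z0).
transitivity (e.+1%:R * 'C(e, z)%:R * a ^+ z * a * x ^+ (e - z)); last first.
  rewrite H (exprS a); ring.
by field.
Qed.

End binomial_mean.

(** * The number of empty queues in an independent sample *)

Section zero_count.
Context {R : realType}.
Variable f : nat -> R.
Hypotheses (f_ge0 : forall k, 0 <= f k).
Hypothesis f_sum : (\esum_(k in [set: nat]) (f k)%:E = 1)%E.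

(** The number of zeros among [e] independent draws from [f] is binomial with parameter [f 0]. The
    induction splits off the first draw. *)
Lemma esum_zero_count e (phi : nat -> R) : (forall z, 0 <= phi z) ->
  (\esum_(l in [set: {ffun 'I_e -> nat}])
     ((\prod_m f (l m)) * phi (\sum_m (l m == 0))%N)%:E)%E =
  (binomial_mean (f 0%N) e phi)%:E.
Proof.
elim: e phi => [|e IHe] phi phi0.
  rewrite (_ : setT = [set ffun0 (card_ord 0)]); last first.
    by apply/seteqP; split => // l _ /=; apply/ffunP => -[].
  rewrite esum_set1; rewrite /binomial_mean ?big_ord_recl !big_ord0.
    by rewrite addr0 bin0 !expr0 !mul1r.
  by rewrite lee_fin mulr_ge0.
pose h (al : nat * {ffun 'I_e -> nat}) : {ffun 'I_e.+1 -> nat} :=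
  [ffun i => if unlift ord0 i is Some j then al.2 j else al.1].
have h0 al : h al ord0 = al.1 by rewrite ffunE unlift_none.
have hS al (j : 'I_e) : h al (lift ord0 j) = al.2 j by rewrite ffunE liftK.
have hbij : set_bij setT setT h.
  split => //.
  - move=> [a l] [b l'] _ _ E; congr pair.
      by have := h0 (a, l); rewrite E h0.
    by apply/ffunP => j; have := hS (a, l) j; rewrite E hS.
  - move=> l _; exists (l ord0, [ffun j => l (lift ord0 j)]) => //.
    apply/ffunP => i; case: (unliftP ord0 i) => [j|] ->; rewrite ?h0 ?hS//=.
    by rewrite ffunE.
rewrite (reindex_esum _ _ _ _ hbij).
pose F a (l : {ffun 'I_e -> nat}) : \bar R :=
  (f a * \prod_i f (l i) * phi ((a == 0) + \sum_i (l i == 0))%N)%:E.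
have F0 a l : (0 <= F a l)%E.
  by rewrite lee_fin !mulr_ge0//; apply: prodr_ge0.
transitivity (\esum_(al in setT) F al.1 al.2)%E.
  apply: eq_esum => al _; rewrite /F !big_ord_recl h0.
  by congr ((_ * _ * phi (_ + _)%N)%:E); apply: eq_bigr => j _; rewrite hS.
rewrite esum_setT_pair//.
have step a : (\esum_(l in [set: {ffun 'I_e -> nat}]) F a l =
    (binomial_mean (f 0%N) e (fun z => phi ((a == 0) + z)%N))%:E * (f a)%:E)%E.
  rewrite -IHe// -ge0_esumZr//; last first.
    by move=> l _; rewrite lee_fin mulr_ge0//; apply: prodr_ge0.
  by apply: eq_esum => l _; rewrite -EFinM mulrC mulrA.
rewrite (eq_esum (fun a _ => step a)).
have bm0 psi : (forall z, 0 <= psi z) -> 0 <= binomial_mean (f 0%N) e psi.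
  move=> psi0; rewrite -lee_fin -IHe//; apply: esum_ge0 => l _.
  by rewrite lee_fin mulr_ge0//; apply: prodr_ge0.
(* Whether the first draw is zero separates the two terms of [binomial_meanS]. *)
rewrite (esumID [set 0%N])//; last first.
  by move=> a _; apply: mule_ge0; rewrite lee_fin//; apply: bm0.
rewrite setTI esum_set1; last first.
  by apply: mule_ge0; rewrite lee_fin//; apply: bm0.
rewrite setTI.
rewrite (eq_esum (b := fun a => (binomial_mean (f 0%N) e phi)%:E * (f a)%:E))%E; last first.
  by move=> a /= /eqP/negbTE ->.
rewrite ge0_esumZl ?bm0//; last by move=> a _; rewrite lee_fin.
have -> : (\esum_(a in ~` [set 0%N]) (f a)%:E = (1 - f 0%N)%:E)%E.
  move: f_sum; rewrite (esumID [set 0%N]); last by move=> k _; rewrite lee_fin.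
  rewrite !setTI esum_set1 ?lee_fin//.
  by rewrite EFinB => <-; rewrite [X in (X - _)%E]addeC addeK.
by rewrite -!EFinM -EFinD binomial_meanS mulrC [(1 - _) * _]mulrC.
Qed.

End zero_count.

(** * Laws on the state space and the probability of joining an empty queue *)

Section law_facts.
Context {R : realType} {n : nat}.
Variable p : state n -> R.
Hypothesis p_law : is_law p.

Lemma law_ge0 s : 0 <= p s. Proof. by have [] := p_law. Qed.

Lemma law_ge0E s : (0 <= (p s)%:E)%E. Proof. by rewrite lee_fin law_ge0. Qed.

#[local] Hint Resolve law_ge0 law_ge0E : core.

(** A partial sum of a law is at most 1, so [fine] in [pr] loses nothing. *)
Lemma prE (B : set (state n)) :
  ((pr p B)%:E = \esum_(s in B) (p s)%:E)%E.
Proof.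
have [_ p1] := p_law; rewrite fineK// ge0_fin_numE ?esum_ge0//.
rewrite (le_lt_trans _ (ltry 1))// -p1 (esumID B setT)// !setTI leeDl//.
exact: esum_ge0.
Qed.

Lemma pr_ge0 B : 0 <= pr p B.
Proof. by rewrite -lee_fin prE esum_ge0. Qed.

Lemma pr_setC B : pr p (~` B) = 1 - pr p B.
Proof.
apply: EFin_inj; rewrite EFinB !prE; have [_ <-] := p_law.
by rewrite (esumID B setT)// !setTI addeAC subee ?add0e// -prE.
Qed.

Lemma length_law0 : length_law p 0 = p None.
Proof.
have H : [set s : state n | queue_length s = 0%N] = [set None].
  by apply/seteqP; split=> -[[]|].
by apply: EFin_inj; rewrite prE H esum_set1.
Qed.

Lemma tail1 : tail p 1 = 1 - p None.
Proof.
rewrite -length_law0 -pr_setC; congr (pr p _).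
by apply/seteqP; split=> -[[]|] //=.
Qed.

Lemma law_None_le1 : p None <= 1.
Proof. by rewrite -subr_ge0 -tail1 pr_ge0. Qed.

Lemma esum_length_law : (\esum_(k in [set: nat]) (length_law p k)%:E = 1)%E.
Proof.
have [_ <-] := p_law.
rewrite -(esum_fiber setT (@queue_length n))//.
by apply: eq_esum => k _; rewrite prE.
Qed.

Lemma join_prob_ge0 d k : 0 <= join_prob d p k.
Proof.
apply: fine_ge0; apply: esum_ge0 => l _; rewrite lee_fin.
rewrite mulr_ge0 ?prodr_ge0//; first by move=> m _; exact: pr_ge0.
by case: ifP => // _; rewrite invr_ge0.
Qed.

(** Length 0 is minimal in every sample, so only the binomial number of ties matters. Both sides are
    the probability that some of [d] independent queues is empty. *)
Lemma join_prob0 d : (0 < d)%N ->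
  d%:R * p None * join_prob d p 0 = 1 - (1 - p None) ^+ d.
Proof.
case: d => // e _; rewrite -length_law0.
rewrite -binomial_mean_inv; congr (_ * _).
rewrite /join_prob -[RHS]/(fine (_%:E)) -esum_zero_count.
- congr fine; apply: eq_esum => l _; congr (_ * _)%:E.
  have -> : [forall m, (0 <= l m)%N] by apply/forallP.
  congr (_.+1%:R^-1); rewrite -sum1_card big_mkcond; apply: eq_bigr => m _.
  by rewrite inE; case: eqP.
- by move=> k; exact: pr_ge0.
- exact: esum_length_law.
- by move=> z; rewrite invr_ge0.
Qed.

End law_facts.

(** * Thinning an equilibrium with memory *)

Section thinning.
Context {R : realType} {n : nat}.

Definition thin (c : R) (p : state n -> R) (s : state n) : R :=
  if s is Some _ then c * p s else 1 - c * (1 - p None).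

Variables (c : R) (p : state n -> R).
Hypotheses (c_gt0 : 0 < c) (c_le1 : c <= 1) (p_law : is_law p).

Let c_ge0 : 0 <= c. Proof. exact: ltW. Qed.

Lemma thin_law : is_law (thin c p).
Proof.
have ge0 s : 0 <= thin c p s.
  case: s => [s|] /=; first by rewrite mulr_ge0// law_ge0.
  rewrite subr_ge0; apply: mulr_ile1 => //; last by rewrite gerBl law_ge0.
  by rewrite subr_ge0 law_None_le1.
split => //; rewrite (esumID [set None]); last by move=> s _; rewrite lee_fin.
rewrite !setTI esum_set1 ?lee_fin//.
rewrite (eq_esum (b := fun s => c%:E * (p s)%:E)%E); last first.
  by move=> -[s _|/(_ erefl)].
rewrite ge0_esumZl//; last by move=> s _; rewrite lee_fin law_ge0.
rewrite -prE// pr_setC// -EFinM -EFinD.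
have -> : pr p [set None] = p None.
  by apply: EFin_inj; rewrite prE// esum_set1// lee_fin law_ge0.
by rewrite subrK.
Qed.

Lemma length_law_thin k : length_law (thin c p) k.+1 = c * length_law p k.+1.
Proof.
apply: EFin_inj; rewrite prE; last exact: thin_law.
rewrite EFinM prE// -ge0_esumZl//; last by move=> s _; rewrite lee_fin law_ge0.
by apply: eq_esum => -[].
Qed.

(** Only samples whose [d.-1] lengths are all at least [k.+1] contribute, so each factor is the
    weight of a nonempty queue and yields one [c]. *)
Lemma join_prob_thin d k :
  join_prob d (thin c p) k.+1 = c ^+ d.-1 * join_prob d p k.+1.
Proof.
rewrite /join_prob -fine_mulZl -ge0_esumZl ?exprn_ge0//; last first.
  move=> l _; rewrite lee_fin mulr_ge0 ?prodr_ge0//.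
    by move=> m _; exact: pr_ge0.
  by case: ifP => // _; rewrite invr_ge0.
congr fine; apply: eq_esum => l _; rewrite -EFinM mulrA.
case: ifPn => [/forallP kl|_]; last by rewrite !mulr0.
congr (_ * _)%:E.
rewrite -[X in c ^+ X](card_ord d.-1) -prodr_const -big_split/=.
apply: eq_bigr => m _; have := kl m; case: (l m) => // j _.
exact: length_law_thin.
Qed.

Variables (d : nat) (alpha : 'rV[R]_n) (A : 'M[R]_n) (lam : R).
Hypothesis d_gt0 : (0 < d)%N.
Hypothesis p_memory : c ^+ d < 1 -> tail p 1 < 1.

(** The [c] in the arrival rate and the [c ^+ d.-1] from the join probability combine to the
    empty-memory probability [c ^+ d]. *)
Lemma arrival_rate_thin k :
  arrival_rate d (lam * c) 1 (thin c p) k.+1 =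
  arrival_rate d lam (c ^+ d) p k.+1.
Proof.
rewrite /arrival_rate/= !addr0 mulr1 join_prob_thin.
case: d d_gt0 => // e _; rewrite exprS /=; ring.
Qed.

(** By [join_prob0] both sides equal [lam * c * (1 - (c * (1 - p None)) ^+ d)]; on the right the
    memory term supplies the missing [1 - c ^+ d]. *)
Lemma arrival_flow0_thin :
  thin c p None * arrival_rate d (lam * c) 1 (thin c p) 0 =
  c * (p None * arrival_rate d lam (c ^+ d) p 0).
Proof.
have := join_prob0 p_law d_gt0; have := join_prob0 thin_law d_gt0.
rewrite /arrival_rate eqxx subrr mulr0 mul0r addr0 mulr1 tail1//.
set j := join_prob d p 0; set j' := join_prob d (thin c p) 0 => H' H.
have -> : thin c p None * (lam * c * d%:R * j') = lam * c * (d%:R * thin c p None * j').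
  ring.
rewrite {}H' [p None * (_ + _)]mulrDr.
have -> : p None * (lam * d%:R * c ^+ d * j) = lam * c ^+ d * (d%:R * p None * j).
  ring.
rewrite {}H.
have -> : p None * (lam * (1 - c ^+ d) / (1 - (1 - p None))) = lam * (1 - c ^+ d).
  (* If [c ^+ d = 1] the memory term vanishes whatever [p None] is; otherwise [p_memory] makes
     [p None] nonzero and it cancels. *)
  have [->|cd1] := eqVneq (c ^+ d) 1; first by rewrite subrr mulr0 mul0r mulr0.
  have p0 : p None != 0.
    have : c ^+ d < 1 by rewrite lt_neqAle cd1 exprn_ile1.
    by move=> /p_memory; rewrite tail1// ltrBlDl ltrDr lt_neqAle eq_sym => /andP[].
  rewrite subKr mulrC mulfVK//.
rewrite /thin subKr exprMn; ring.
Qed.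

(** All flows are multiplied by the same constant, hence global balance is preserved. *)
Lemma flow_thin s t :
  thin c p s * rate d alpha A (lam * c) 1 (thin c p) s t =
  c * (p s * rate d alpha A lam (c ^+ d) p s t).
Proof.
case: s t => [[k i]|] [[l j]|]; rewrite /rate ?mulr0//.
- by rewrite arrival_rate_thin /= mulrA.
- by rewrite /= mulrA.
- by case: eqP => _; rewrite ?mulr0// [LHS]mulrA arrival_flow0_thin -!mulrA.
Qed.

(** The condition [t <> s] keeps out the diagonal entries of [A], which may be negative. *)
Lemma rate_ge0 q (pi : R) (law_q : is_law q) s t :
  stochastic_vector alpha -> subgenerator A -> 0 <= lam -> 0 <= pi <= 1 ->
  t <> s -> 0 <= rate d alpha A lam pi q s t.
Proof.
move=> [alpha0 _] [Aoff Arow] lam0 /andP[pi0 pi1] ts.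
have nu0 i : 0 <= completion_rate A i.
  rewrite oppr_ge0 mxE; apply: le_trans (Arow i).
  by apply: ler_sum => j _; rewrite mxE mulr1.
have ar0 k : 0 <= arrival_rate d lam pi q k.
  apply: addr_ge0; first by rewrite !mulr_ge0// join_prob_ge0.
  case: ifP => // _; rewrite !mulr_ge0 ?subr_ge0// invr_ge0 subr_ge0.
  by rewrite tail1// lerBlDr lerDl law_ge0.
case: s t ts => [[k i]|] [[l j]|] //= ts.
- case: ifP => _; first by case: ifP.
  case: eqP => [lk|_]; last by case: ifP => // _; rewrite mulr_ge0.
  by apply: Aoff; apply: contra_notN ts => /eqP ->; rewrite lk.
- by case: ifP.
- by case: ifP => // _; rewrite mulr_ge0.
Qed.

Lemma thin_equilibrium :
  stochastic_vector alpha -> subgenerator A -> 0 <= lam ->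
  equilibrium d alpha A lam (c ^+ d) p ->
  equilibrium d alpha A (lam * c) 1 (thin c p).
Proof.
move=> sa sA lam0 [_ _ stat]; split; first exact: thin_law.
  by rewrite ltxx.
move=> s; have cd01 : 0 <= c ^+ d <= 1 by rewrite exprn_ge0// exprn_ile1.
under eq_esum do rewrite flow_thin EFinM.
under [RHS]eq_esum do rewrite flow_thin EFinM.
have flow_ge0 u v : v <> u ->
    (0 <= (p u * rate d alpha A lam (c ^+ d) p u v)%:E)%E.
  by move=> uv; rewrite lee_fin; apply: mulr_ge0; [exact: law_ge0|exact: rate_ge0].
rewrite !ge0_esumZl ?stat//.
- by move=> t /= ts; apply: flow_ge0; exact/nesym.
- by move=> t; exact: flow_ge0.
Qed.

End thinning.

(** * Response times *)

Section response.
Context {R : realType} {d n : nat}.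

(** Finite functions keep the type countable, so that probabilities of choice events can be
    summed. *)
Definition choice_index : countType :=
  (bool * {ffun 'I_d -> option (nat * 'I_n)} * 'I_d)%type.

(** With an id in memory the job goes to an idle server, so it finds the empty state. *)
Definition head_state (x : choice_index) : state n :=
  if x.1.1 then x.1.2 x.2 else None.

Definition choice_weight (pi0 : R) (p : state n -> R) (x : choice_index) : R :=
  (if x.1.1 then pi0 else 1 - pi0) * (\prod_m p (x.1.2 m)) *
  select R (fun m => queue_length (x.1.2 m)) x.2.

Lemma select_ge0 (l : 'I_d -> nat) i : 0 <= select R l i.
Proof. by rewrite /select; case: ifP => // _; rewrite invr_ge0. Qed.

Lemma choice_weight_ge0 pi0 p x : 0 <= pi0 <= 1 -> is_law p ->
  0 <= choice_weight pi0 p x.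
Proof.
move=> /andP[pi0_ge0 pi0_le1] [p0 _]; rewrite mulr_ge0 ?select_ge0//.
by rewrite mulr_ge0 ?prodr_ge0//; case: ifP => _; rewrite ?subr_ge0.
Qed.

Lemma choice_weight_thin c p x k j : head_state x = Some (k, j) ->
  choice_weight 1 (thin c p) x = choice_weight (c ^+ d) p x.
Proof.
case: x => [[b q] i]; rewrite /head_state/choice_weight/=.
case: b => // qi; rewrite mul1r /select.
(* A nonzero selection weight makes the chosen queue a shortest one; it is nonempty, so all [d]
   queues are, and each contributes one [c]. *)
case: ifPn => [/forallP qmin|_]; last by rewrite !mulr0.
congr (_ * _); rewrite -[X in c ^+ X](card_ord d) -prodr_const -big_split/=.
by apply: eq_bigr => m _; have := qmin m; rewrite qi; case: (q m).
Qed.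

(** The choice enters the response time only through the state [H] found by the job. Events of [H]
    are countable disjoint unions of choice events, so independence passes to [H]. *)
Lemma response_time_head (alpha : 'rV[R]_n) (A : 'M[R]_n) (pi0 : R)
    (p : state n -> R) (dT : measure_display) (T : measurableType dT)
    (P : probability T R) (X : {RV P >-> R}) :
  0 <= pi0 <= 1 -> is_law p ->
  response_time d alpha A pi0 p X ->
  exists (H : T -> state n) (Y : 'I_n -> {RV P >-> R}) (S : nat -> {RV P >-> R}),
  [/\ (forall s, measurable (H @^-1` [set s]) /\
        (P (H @^-1` [set s]) =
         \esum_(x in head_state @^-1` [set s]) (choice_weight pi0 p x)%:E)%E),
      (forall j, PH_law (delta_mx 0 j) A (distribution P (Y j))),
      (forall k, PH_law alpha A (distribution P (S k))),
      (forall s N (U : 'I_n -> set R) (V : nat -> set R),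
        (forall j, measurable (U j)) -> (forall k, measurable (V k)) ->
        P (H @^-1` [set s] `&`
           [set t | (forall j, U j (Y j t)) /\
                    (forall k, (k < N)%N -> V k (S k t))]) =
        (P (H @^-1` [set s]) * ((\prod_j P (Y j @^-1` U j)) *
         (\prod_(k < N) P (S k @^-1` V k))))%E) &
      (forall t, X t =
        S 0%N t +
        (if H t is Some (k, j) then Y j t + \sum_(m < k) S m.+1 t else 0))].
Proof.
move=> pi01 p_law [E [Q [J [Y [S [choiceP YP SP indep XE]]]]]].
pose F (x : choice_index) :=
  [set t | [/\ E t = x.1.1, forall m, Q m t = x.1.2 m & J t = x.2]].
have F_meas x : measurable (F x) by exact: (choiceP _ _ _).1.
have F_prob x : P (F x) = (choice_weight pi0 p x)%:E by exact: (choiceP _ _ _).2.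
have F_triv D : trivIset D F.
  move=> [[b q] i] [[b' q'] i'] _ _ [t [[/= Eb Qq Ji] [/= Eb' Qq' Ji']]].
  rewrite -Eb -Eb' -Ji -Ji'; congr (_, _, _).
  by apply/ffunP => m; rewrite -Qq -Qq'.
pose H t : state n := if E t then Q (J t) t else None.
have HE s : H @^-1` [set s] = \bigcup_(x in head_state @^-1` [set s]) F x.
  apply/seteqP; split => t /=.
    move=> Hs; exists (E t, [ffun m => Q m t], J t).
      by rewrite -Hs /head_state/= ffunE.
    by split => //= m; rewrite ffunE.
  by move=> [x <-] [Ex Qx Jx]; rewrite /H /head_state Ex Qx Jx.
exists H, Y, S; split => //.
- move=> s; rewrite HE; split.
    by apply: countType_bigcup_measurable => x _; exact: F_meas.
  by rewrite measure_bigcup_esum//; apply: eq_esum => x _; exact: F_prob.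
- move=> s N U V mU mV; rewrite HE setI_bigcupl.
  set K := (X in (_ * X)%E).
  have K_fin : K \is a fin_num.
    apply: fin_numM; apply: prode_fin_num => ? _; apply: fin_num_measure;
      rewrite -[X in measurable X]setTI; exact: measurable_funP.
  set C := [set t | _ /\ _].
  have mC : measurable C.
    have -> : C = \bigcap_(j in [set: 'I_n]) (Y j @^-1` U j) `&`
        [set t | forall k, (k < N)%N -> V k (S k t)].
      apply/seteqP; split => t /= [HU HV]; split=> // j *; exact: HU.
    apply: measurableI; last exact: measurable_cylinder.
    apply: fin_bigcap_measurable => // j _.
    by rewrite -[X in measurable X]setTI; exact: measurable_funP.
  rewrite !measure_bigcup_esum//; first last.
  + exact: trivIset_setIr.
  + by move=> x _; exact: measurableI.
  rewrite -(fineK K_fin) -ge0_esumZr//.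
  + apply: eq_esum => x _; rewrite fineK// /K muleA.
    exact: indep.
  + by apply: fine_ge0; rewrite /K mule_ge0//; apply: prode_ge0.
- by move=> t; rewrite XE /H; case: (E t).
Qed.

End response.

(** * Comparing two response times given the state found *)

Section comparison.
Context {R : realType} {n : nat}.

(** The summands of the response time as one sequence: in state [s] it is the sum of the first
    [(queue_length s).+1] terms. *)
Definition work_term (T : Type) (Y : 'I_n -> T -> R) (S : nat -> T -> R)
    (s : state n) (k : nat) : T -> R :=
  if s is Some (_, j) then (if k is k'.+1 then S k' else Y j) else S k.

(** [U], [V'] and [N'] are chosen before [T], [Y] and [S], so the same ones serve both systems. *)
Lemma work_term_cylinder (s : state n) N (V : nat -> set R) :
  (forall k, measurable (V k)) ->
  exists (U : 'I_n -> set R) (V' : nat -> set R) (N' : nat),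
  [/\ forall j, measurable (U j), forall k, measurable (V' k) &
      forall (T : Type) (Y : 'I_n -> T -> R) (S : nat -> T -> R),
        [set t | forall k, (k < N)%N -> V k (work_term Y S s k t)] =
        [set t | (forall j, U j (Y j t)) /\
                 (forall k, (k < N')%N -> V' k (S k t))]].
Proof.
move=> mV; case: s => [[l j]|]; last first.
  exists (fun=> setT), V, N; split => // T Y S.
  by apply/seteqP; split => t //= -[].
case: N => [|N].
  exists (fun=> setT), V, 0%N; split => // T Y S.
  by apply/seteqP; split.
exists (fun i => if i == j then V 0%N else setT), (fun k => V k.+1), N.
split => [i||T Y S]; [by case: ifP|by []|].
apply/seteqP; split => t /=.
  move=> VW; split=> [i|k kN]; last exact: VW k.+1 kN.
  by case: eqP => // ->; exact: VW 0%N isT.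
move=> [UY VS] [_|k kN]; last exact: VS.
by have := UY j; rewrite eqxx.
Qed.

Variables (d d' : measure_display) (T : measurableType d) (T' : measurableType d').
Variables (P : probability T R) (P' : probability T' R).
Variables (H : T -> state n) (H' : T' -> state n).
Hypothesis mH : forall s, measurable (H @^-1` [set s]).
Hypothesis mH' : forall s, measurable (H' @^-1` [set s]).

Lemma head_None_prob (d0 : measure_display) (T0 : measurableType d0)
    (P0 : probability T0 R) (H0 : T0 -> state n) :
  (forall s, measurable (H0 @^-1` [set s])) ->
  P0 (H0 @^-1` [set None]) =
  (1 - \esum_(s in ~` [set None]) P0 (H0 @^-1` [set s]))%E.
Proof.
move=> mH0; have -> : H0 @^-1` [set None] =
    ~` \bigcup_(s in ~` [set None]) (H0 @^-1` [set s]).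
  apply/seteqP; split => t /=.
    by move=> Ht [s /= sN Hs]; apply: sN; rewrite -Hs.
  by move=> Ht; apply: contrapT => HN; apply: Ht; exists (H0 t).
rewrite probability_setC; last exact: countType_bigcup_measurable.
by rewrite measure_bigcup_esum// => s s' _ _ [t [<- <-]].
Qed.

(** The choice weights leading to the empty state may differ between the systems; its probability is
    recovered as the complement of the others. *)
Lemma head_prob_eq :
  (forall k j, P (H @^-1` [set Some (k, j)]) = P' (H' @^-1` [set Some (k, j)])) ->
  forall s, P (H @^-1` [set s]) = P' (H' @^-1` [set s]).
Proof.
move=> HH' [[k j]|]; first exact: HH'.
rewrite !head_None_prob//; congr (1 - _)%E.
by apply: eq_esum => -[[k j] _|/(_ erefl)//]; exact: HH'.
Qed.

Lemma distribution_eq_head (X : {RV P >-> R}) (X' : {RV P' >-> R}) :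
  (forall s B, measurable B ->
    P (H @^-1` [set s] `&` X @^-1` B) = P' (H' @^-1` [set s] `&` X' @^-1` B)) ->
  forall B, measurable B -> distribution P X B = distribution P' X' B.
Proof.
move=> HX B mB.
have E (d0 : measure_display) (T0 : measurableType d0) (P0 : probability T0 R)
    (H0 : T0 -> state n) (X0 : {RV P0 >-> R}) :
  (forall s, measurable (H0 @^-1` [set s])) ->
  distribution P0 X0 B =
  (\esum_(s in [set: state n]) P0 (H0 @^-1` [set s] `&` X0 @^-1` B))%E.
  move=> mH0; rewrite /distribution/pushforward -measure_bigcup_esum.
  - by congr (P0 _); apply/seteqP; split=> [t Bt|t [s _ []]//]; exists (H0 t).
  - move=> s _; apply: measurableI => //.
    by rewrite -[X in measurable X]setTI; exact: measurable_funP.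
  - by move=> s s' _ _ [t [[<- _] [<- _]]].
by rewrite (E _ _ _ H)// (E _ _ _ H')//; apply: eq_esum => s _; exact: HX.
Qed.

(** Once the state found is fixed, the number of summands is fixed too, and partial sums can be
    compared on that event. *)
Lemma response_distribution_eq
    (Y : 'I_n -> {RV P >-> R}) (S : nat -> {RV P >-> R})
    (Y' : 'I_n -> {RV P' >-> R}) (S' : nat -> {RV P' >-> R})
    (X : {RV P >-> R}) (X' : {RV P' >-> R}) :
  (forall s N (U : 'I_n -> set R) (V : nat -> set R),
    (forall j, measurable (U j)) -> (forall k, measurable (V k)) ->
    P (H @^-1` [set s] `&`
       [set t | (forall j, U j (Y j t)) /\
                (forall k, (k < N)%N -> V k (S k t))]) =
    P' (H' @^-1` [set s] `&`
       [set t | (forall j, U j (Y' j t)) /\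
                (forall k, (k < N)%N -> V k (S' k t))])) ->
  (forall t, X t = S 0%N t +
    (if H t is Some (k, j) then Y j t + \sum_(m < k) S m.+1 t else 0)) ->
  (forall t, X' t = S' 0%N t +
    (if H' t is Some (k, j) then Y' j t + \sum_(m < k) S' m.+1 t else 0)) ->
  forall B, measurable B -> distribution P X B = distribution P' X' B.
Proof.
move=> HW XE XE'; apply: distribution_eq_head => s B mB.
have W_sum (T0 : Type) (X0 : T0 -> R) (H0 : T0 -> state n)
    (Y0 : 'I_n -> T0 -> R) (S0 : nat -> T0 -> R) :
  (forall t, X0 t = S0 0%N t +
    (if H0 t is Some (k, j) then Y0 j t + \sum_(m < k) S0 m.+1 t else 0)) ->
  H0 @^-1` [set s] `&` X0 @^-1` B =
  H0 @^-1` [set s] `&`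
    [set t | B (\sum_(k < (queue_length s).+1) work_term Y0 S0 s k t)].
  move=> X0E; have XW t : H0 t = s ->
      X0 t = \sum_(k < (queue_length s).+1) work_term Y0 S0 s k t.
    rewrite X0E => ->; case: s => [[k j]|] /=; last by rewrite big_ord1 addr0.
    by rewrite !big_ord_recl/= addrCA.
  by apply/seteqP; split => t /= [Hs]; rewrite XW.
have EP := congr1 (fun D => P D) (W_sum _ X H (fun j => Y j) (fun k => S k) XE).
have EP' := congr1 (fun D => P' D) (W_sum _ X' H' (fun j => Y' j) (fun k => S' k) XE').
rewrite [LHS]EP [RHS]EP' {EP EP' W_sum}.
have mW (d0 : measure_display) (T0 : measurableType d0) (P0 : probability T0 R)
    (Y0 : 'I_n -> {RV P0 >-> R}) (S0 : nat -> {RV P0 >-> R}) k :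
    measurable_fun setT (work_term Y0 S0 s k).
  by rewrite /work_term; case: s => [[? ?]|]; case: k => [|?]; exact: measurable_funP.
apply: partial_sum_preimage_eq => // N V mV.
have [U [V' [N' [mU mV' WE]]]] := work_term_cylinder s N mV.
by rewrite !WE; exact: HW.
Qed.

End comparison.

Theorem theorem3 (R : realType) (d n : nat) (alpha : 'rV[R]_n) (A : 'M[R]_n)
    (G : probability (measurableTypeR R) R) (mu lam pi0 : R)
    (p p' : state n -> R)
    (dT : measure_display) (T : measurableType dT) (P : probability T R)
    (dT' : measure_display) (T' : measurableType dT') (P' : probability T' R)
    (X : {RV P >-> R}) (X' : {RV P' >-> R}) :
  (1 <= d)%N ->
  stochastic_vector alpha ->
  subgenerator A ->
  PH_law alpha A G ->
  (\int[G]_x x%:E = (mu^-1)%:E)%E ->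
  0 < lam -> lam < mu ->
  0 < pi0 -> pi0 <= 1 ->
  unique (equilibrium d alpha A lam pi0) p ->
  unique (equilibrium d alpha A (lam * pi0 `^ (d%:R^-1)) 1) p' ->
  response_time d alpha A pi0 p X ->
  response_time d alpha A 1 p' X' ->
  forall B : set R, measurable B -> distribution P X B = distribution P' X' B.
Proof.
move=> d_gt0 sa sA _ _ lam_gt0 _ pi0_gt0 pi0_le1 [p_eq _] [_ p'_uniq].
set c := pi0 `^ (d%:R^-1) in p'_uniq *.
have cd : c ^+ d = pi0.
  by rewrite -powR_mulrn ?powR_ge0// -powRrM mulVf ?powRr1 ?ltW// pnatr_eq0 -lt0n.
have c_gt0 : 0 < c by exact: powR_gt0.
have c_le1 : c <= 1 by rewrite -(expr_le1 d_gt0) ?cd// ltW.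
have [p_law p_tail _] := p_eq.
rewrite -{}cd in p_eq p_tail pi0_gt0 pi0_le1 *.
have -> : p' = thin c p.
  by apply: p'_uniq; apply: thin_equilibrium => //; exact: ltW.
move=> XP XP'.
have pi01 : 0 <= c ^+ d <= 1 by rewrite ltW.
have one01 : (0 : R) <= (1 : R) <= (1 : R) by rewrite ler01 lexx.
have [H [Y [S [HP YP SP indep XE]]]] := response_time_head pi01 p_law XP.
have [H' [Y' [S' [HP' YP' SP' indep' XE']]]] :=
  response_time_head one01 (thin_law c_gt0 c_le1 p_law) XP'.
have HH' : forall s, P (H @^-1` [set s]) = P' (H' @^-1` [set s]).
  apply: head_prob_eq => [s|s|k j]; [exact: (HP s).1|exact: (HP' s).1|].
  rewrite (HP _).2 (HP' _).2; apply: eq_esum => x /= xs.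
  by rewrite (choice_weight_thin _ _ xs).
have delta1 j : \sum_i (delta_mx 0 j : 'rV[R]_n) 0 i = 1.
  rewrite (bigD1 j)//= big1 ?addr0 ?mxE ?eqxx// => i ij.
  by rewrite mxE (negbTE ij).
apply: (response_distribution_eq _ _ _ XE XE') => [s|s|s N U V mU mV].
- exact: (HP s).1.
- exact: (HP' s).1.
(* Both joint probabilities factor; the state factors agree by [HH'] and the others by uniqueness of
   PH laws. *)
rewrite indep// indep'// HH'; congr (_ * (_ * _))%E; apply: eq_bigr => i _.
  exact: (PH_law_unique (delta1 i) (YP i) (YP' i)).
by have [_ alpha1] := sa; exact: (PH_law_unique alpha1 (SP i) (SP' i)).
Qed.
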